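(* Let $D$ be an integral domain and let $\mathcal{X}$ be a property of integral domains. Then the following assertions hold. (1) $D$ is a locally $\mathcal{X}$-domain if and only if every flat overring of $D$ is a locally $\mathcal{X}$-domain. (2) $D$ is a $t$-locally $\mathcal{X}$-domain if and only if every $t$-flat overring of $D$ is a $t$-locally $\mathcal{X}$-domain. (3) If $\mathcal{X}$ is stable under the quotient extension, then: (a) $D$ is a locally $\mathcal{X}$-domain if and only if $D_M$ has the property $\mathcal{X}$ for all maximal ideals $M$ of $D$; (b) $D$ is a $t$-locally $\mathcal{X}$-domain if and only if $D_M$ has the property $\mathcal{X}$ for all maximal $t$-ideals $M$ of $D$.
   Context: Properties of integral domains are understood to be invariant under ring isomorphism. For an integral domain $D$ with quotient field $K$ and a nonzero fractional ideal $I$, put $I^{-1}=\{a\in K \mid aI\subseteq D\}$, $I_v=(I^{-1})^{-1}$ and $I_t=\bigcup\{J_v \mid J \text{ a nonzero finitely generated fractional subideal of } I\}$. A nonzero ideal $I$ is a $t$-ideal if $I_t=I$; a prime $t$-ideal is a nonzero prime ideal that is a $t$-ideal; a maximal $t$-ideal is an ideal maximal among the proper $t$-ideals (such ideals are prime). $D$ is a locally $\mathcal{X}$-domain (respectively, $t$-locally $\mathcal{X}$-domain) if $D_P$ has the property $\mathcal{X}$ for every prime ideal (respectively, every prime $t$-ideal) $P$ of $D$. An overring of $D$ is a ring $T$ with $D\subseteq T\subseteq K$; it is a flat overring if it is flat as a $D$-module, and a $t$-flat overring if $T_Q=D_{Q\cap D}$ for every prime $t$-ideal $Q$ of $T$ (equivalently,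 for every maximal $t$-ideal $Q$ of $T$). $\mathcal{X}$ is stable under the quotient extension if, whenever a domain $D$ has $\mathcal{X}$, so does $D_S$ for every multiplicative subset $S$ of $D$ (not containing $0$). *)

(* Defs.v *)
From HB Require Import structures.
From mathcomp Require Import all_boot all_order all_algebra generic_quotient.
From mathcomp Require Import boolp classical_sets.
From mathcomp Require Import freeg.

Set Implicit Arguments.
Unset Strict Implicit.
Unset Printing Implicit Defensive.

Import GRing.Theory.

Local Open Scope classical_set_scope.
Local Open Scope ring_scope.
Local Open Scope quotient_scope.

(* Integral domains occur as subrings of a field K, given as sets; a domain
   A, its localizations and its overrings are all subrings of its quotient
   field.  The properties X themselves are predicates on [idomainType]. *)

Definition subring (K : fieldType) (A : set K) : Prop :=
  subring_closed [in A].

Definition subring_pred (K : fieldType) (A : set K) of subring A : {pred K} :=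
  [in A].

HB.instance Definition _ (K : fieldType) (A : set K) (hA : subring A) :=
  GRing.isSubringClosed.Build K (subring_pred hA) hA.

Definition domain_of (K : fieldType) (A : set K) (hA : subring A) : Type :=
  {x : K | x \in subring_pred hA}.

Section DomainOf.
Variables (K : fieldType) (A : set K) (hA : subring A).
Local Notation dA := (domain_of hA).

HB.instance Definition _ := SubChoice.on dA.
HB.instance Definition _ := [SubChoice_isSubComNzRing of dA by <:].

Let unitd : pred dA := fun x => (val x != 0) && ((val x)^-1 \in A).
Let invd (x : dA) : dA := insubd x (val x)^-1.

Let mulVd : {in unitd, left_inverse 1 invd *%R}.
Proof.
move=> x /andP[x0 xV]; apply: val_inj.
by rewrite rmorphM rmorph1 /= /invd val_insubd xV mulVf.
Qed.

Let unitdP (x y : dA) : y * x = 1 -> unitd x.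
Proof.
move=> /(congr1 val); rewrite rmorphM rmorph1 /= => yx1.
have x0 : val x != 0.
  by apply: contra_eq_neq yx1 => ->; rewrite mulr0 eq_sym oner_neq0.
apply/andP; split=> //; suff <- : val y = (val x)^-1 by exact: (valP y).
by apply: (mulIf x0); rewrite yx1 mulVf.
Qed.

Let invd_out : {in [predC unitd], invd =1 id}.
Proof.
move=> x; rewrite inE negb_and negbK => xU; apply: val_inj.
rewrite /invd val_insubd; case: ifP => // xV.
by case/orP: xU => [/eqP -> | /negP //]; rewrite invr0.
Qed.

HB.instance Definition _ :=
  GRing.ComNzRing_hasMulInverse.Build dA mulVd unitdP invd_out.

Let mulfd (x y : dA) : x * y = 0 -> (x == 0) || (y == 0).
Proof.
move=> /(congr1 val); rewrite rmorphM rmorph0 /= => /eqP.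
by rewrite mulf_eq0 -!(inj_eq val_inj).
Qed.

HB.instance Definition _ := GRing.ComUnitRing_isIntegral.Build dA mulfd.

End DomainOf.

Definition iso_invariant (X : idomainType -> Prop) : Prop :=
  forall (A B : idomainType) (f : {rmorphism A -> B}),
    bijective f -> X A -> X B.

Definition has_property (X : idomainType -> Prop) (K : fieldType) (A : set K)
    : Prop :=
  exists hA : subring A, X (domain_of hA).

Section Domains.
Variable K : fieldType.
Implicit Types A T I J M P Q S : set K.

Definition is_quotient_field A : Prop :=
  subring A /\ forall x : K, exists a b, [/\ A a, A b, b != 0 & x = a / b].

Definition multiplicative A S : Prop :=
  [/\ S `<=` A, S 1, ~ S 0 & forall x y, S x -> S y -> S (x * y)].

Definition localization A S : set K :=
  [set x | exists a s, [/\ A a, S s & x = a / s]].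

Definition localization_at A P : set K := localization A (A `\` P).

Definition submodule A I : Prop :=
  [/\ I 0, forall x y, I x -> I y -> I (x + y)
    & forall a x, A a -> I x -> I (a * x)].

Definition ideal A I : Prop := submodule A I /\ I `<=` A.

Definition prime_ideal A P : Prop :=
  [/\ ideal A P, P <> A
    & forall x y, A x -> A y -> P (x * y) -> P x \/ P y].

Definition maximal_ideal A M : Prop :=
  [/\ ideal A M, M <> A
    & forall I, ideal A I -> I <> A -> M `<=` I -> I = M].

Definition fractional_ideal A I : Prop :=
  submodule A I /\ exists d, [/\ A d, d != 0 & forall x, I x -> A (d * x)].

(* J is the A-submodule of K generated by the finite list s *)
Definition generated_by A (s : seq K) J : Prop :=
  [/\ submodule A J, forall x, x \in s -> J x
    & forall I, submodule A I -> (forall x, x \in s -> I x) -> J `<=` I].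

Definition finitely_generated A J : Prop := exists s, generated_by A s J.

(* The quotient field of A must be the whole of K for the next operations to
   be the usual ones. *)
Definition inverse_ideal A I : set K :=
  [set a | forall x, I x -> A (a * x)].

Definition v_closure A I : set K := inverse_ideal A (inverse_ideal A I).

Definition t_closure A I : set K :=
  [set x | exists J, [/\ fractional_ideal A J, J <> [set 0],
                         finitely_generated A J, J `<=` I & v_closure A J x]].

Definition t_ideal A I : Prop :=
  [/\ ideal A I, I <> [set 0] & t_closure A I = I].

Definition prime_t_ideal A P : Prop := prime_ideal A P /\ t_ideal A P.

Definition maximal_t_ideal A M : Prop :=
  [/\ t_ideal A M, M <> A
    & forall I, t_ideal A I -> I <> A -> M `<=` I -> I = M].

Definition locally (X : idomainType -> Prop) A : Prop :=
  forall P, prime_ideal A P -> has_property X (localization_at A P).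

Definition t_locally (X : idomainType -> Prop) A : Prop :=
  forall P, prime_t_ideal A P -> has_property X (localization_at A P).

End Domains.

Definition stable_under_quotient_extension (X : idomainType -> Prop) : Prop :=
  forall (K : fieldType) (A S : set K),
    multiplicative A S -> has_property X A ->
    has_property X (localization A S).

(* The tensor product of R-modules M and V is the free abelian group on M * V
   modulo the subgroup generated by the bilinearity relations;
   [tensor_null z] says that z lies in that subgroup. *)
Section Tensor.
Variables (R : comNzRingType) (M V : lmodType R).
Local Notation F := {freeg (M * V)%type / int}.

Definition tensor_relation : set F :=
  [set z | (exists m1 m2 v,
              z = << (m1 + m2, v) >> - << (m1, v) >> - << (m2, v) >>)
        \/ (exists m v1 v2,
              z = << (m, v1 + v2) >> - << (m, v1) >> - << (m, v2) >>)
        \/ (exists r m v, z = << (r *: m, v) >> - << (m, r *: v) >>)].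

Definition tensor_null (z : F) : Prop :=
  forall H : set F,
    H 0 -> (forall x y, H x -> H y -> H (x - y)) ->
    tensor_relation `<=` H -> H z.

End Tensor.

(* Tensoring with V preserves injectivity: [fglift _ z] below is the image of
   z under the map of free abelian groups sending (m, v) to (f m, v). *)
Definition flat_module (R : comNzRingType) (V : lmodType R) : Prop :=
  forall (M N : lmodType R) (f : {linear M -> N}), injective f ->
  forall z : {freeg (M * V)%type / int},
    tensor_null
      (fglift (fun mv => << (f mv.1, mv.2) >> : {freeg (N * V)%type / int}) z) ->
    tensor_null z.

Definition overring (K : fieldType) (A T : set K) : Prop :=
  subring T /\ A `<=` T.

(* T as a module over its subring A *)
Definition ext_module (K : fieldType) (A T : set K)
    (hA : subring A) (hT : subring T) of A `<=` T : Type := domain_of hT.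

Section ExtModule.
Variables (K : fieldType) (A T : set K).
Variables (hA : subring A) (hT : subring T) (AT : A `<=` T).
Local Notation E := (ext_module hA hT AT).

HB.instance Definition _ := GRing.Zmodule.on E.

Let incl_subproof (a : domain_of hA) : val a \in subring_pred hT.
Proof. by apply/mem_set/AT/set_mem; exact: (valP a). Qed.

Definition ext_incl (a : domain_of hA) : domain_of hT :=
  Sub (val a) (incl_subproof a).

Definition ext_scale (a : domain_of hA) (x : E) : E :=
  ext_incl a * (x : domain_of hT).

Let ext_scaleA a b x : ext_scale a (ext_scale b x) = ext_scale (a * b) x.
Proof. by apply: val_inj; rewrite /= mulrA. Qed.

Let ext_scale1 : left_id 1 ext_scale.
Proof. by move=> x; apply: val_inj; rewrite /= mul1r. Qed.

Let ext_scaleDr : right_distributive ext_scale +%R.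
Proof. by move=> a x y; apply: val_inj; rewrite /= mulrDr. Qed.

Let ext_scaleDl x : {morph ext_scale^~ x : a b / a + b}.
Proof. by move=> a b; apply: val_inj; rewrite /= mulrDl. Qed.

HB.instance Definition _ := GRing.Zmodule_isLmodule.Build (domain_of hA) E
  ext_scaleA ext_scale1 ext_scaleDr ext_scaleDl.

End ExtModule.

Definition flat_overring (K : fieldType) (A T : set K) : Prop :=
  exists (hA : subring A) (hT : subring T) (AT : A `<=` T),
    flat_module (ext_module hA hT AT).

Definition t_flat_overring (K : fieldType) (A T : set K) : Prop :=
  overring A T /\
  forall Q, prime_t_ideal T Q ->
    localization_at T Q = localization_at A (Q `&` A).

(* Every integral domain arises this way, as a subring of its fraction field. *)
Lemma fraction_is_quotient_field (R : idomainType) :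
  is_quotient_field (range (@tofrac R)).
Proof.
split=> [|x].
  split; first by apply/mem_set; exists 1; rewrite ?rmorph1.
    move=> _ _ /set_mem[a _ <-] /set_mem[b _ <-].
    by apply/mem_set; exists (a - b); rewrite ?rmorphB.
  move=> _ _ /set_mem[a _ <-] /set_mem[b _ <-].
  by apply/mem_set; exists (a * b); rewrite ?rmorphM.
elim/quotP: x => r _; set n := (frac r).1; set d := (frac r).2.
have d0 : d != 0 by exact: denom_ratioP.
have dF : tofrac d != 0 by rewrite tofrac_eq0.
exists (tofrac n), (tofrac d); split=> //; try by eexists.
apply: (mulIf dF); rewrite divfK // !piE; apply/eqP.
by rewrite equivf_def !numden_Ratio ?mulr1 ?mul1r ?oner_neq0 ?mulf_neq0 // mulrC.
Qed.

(* Main.v *)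
Require Import Defs.
From HB Require Import structures.
From mathcomp Require Import all_boot all_order all_algebra.
From mathcomp Require Import boolp classical_sets.
From mathcomp Require Import freeg ring.

Set Implicit Arguments.
Unset Strict Implicit.
Unset Printing Implicit Defensive.

Import GRing.Theory.

(** Two facts about localizations of D inside its quotient field K carry the
    proposition.

    An overring T that is flat, or t-flat, has no new localizations:
    T_Q = D_(Q /\ D) for every prime (prime t-) ideal Q of T.  For t-flat
    overrings this is the definition.  For flat ones, every x in T has a
    denominator s in D outside Q with s x in D: writing x = a / b, the element
    a (x) 1 - b (x) x of (bD + aD) (x) T dies in D (x) T, so by flatness it is
    already zero, and this forces 1 into the extension to T of the ideal of
    denominators of x ([flat_denominator]).  Since also Q /\ D is a prime
    (prime t-) ideal of D, the property X passes from the localizations of D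
    to those of T; the converse holds because D is a flat and a t-flat overring
    of itself ([flat_overring_refl], [t_flat_overring_refl]).

    In the t-case the contraction of a t-ideal need not be a t-ideal for an
    arbitrary overring.  For a t-flat T it is ([t_flat_contraction]), because T
    is the intersection of its localizations at prime t-ideals
    ([mem_localizations]) and these are localizations of D: if a finite set s
    is contained in Q /\ D and x is in its v-closure over D, clearing
    denominators at each of those primes shows that x is in the v-closure of s
    over T, which is contained in Q.

    For the third assertion, every proper ideal (t-ideal) lies in a maximal one
    by Zorn's lemma, and maximal ones are prime; then D_P is a localization of
    D_M whenever P is contained in M ([localization_trans]).

    Ideals and t-ideals are handled together through colon ideals (I : x):
    closure of a class of ideals under colons makes its maximal members prime
    ([maximal_prime]), and closure under unions of chains makes them exist
    ([exists_maximal_proper]). *)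

Local Open Scope classical_set_scope.
Local Open Scope ring_scope.

(** * Subrings, ideals and colon ideals *)

Section SubringTheory.
Context (K : fieldType) (A : set K) (hA : subring A).

Lemma subring1 : A 1.
Proof. by case: hA => /set_mem. Qed.

Lemma subringB x y : A x -> A y -> A (x - y).
Proof. by case: hA => _ hB _ /mem_set Ax /mem_set Ay; apply/set_mem/hB. Qed.

Lemma subringM x y : A x -> A y -> A (x * y).
Proof. by case: hA => _ _ hM /mem_set Ax /mem_set Ay; apply/set_mem/hM. Qed.

Lemma subring0 : A 0.
Proof. by rewrite -(subrr 1); apply: subringB; exact: subring1. Qed.

Lemma subringD x y : A x -> A y -> A (x + y).
Proof.
move=> Ax Ay; rewrite -[y]opprK; apply: subringB => //.
by rewrite -sub0r; apply: subringB => //; exact: subring0.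
Qed.

Lemma subring_submodule : submodule A A.
Proof. by split; [exact: subring0 | exact: subringD | exact: subringM]. Qed.

Lemma submoduleB I x y : submodule A I -> I x -> I y -> I (x - y).
Proof.
move=> [_ ID IM] Ix Iy; apply: ID => //; rewrite -mulN1r; apply: IM => //.
by rewrite -sub0r; apply: subringB; [exact: subring0 | exact: subring1].
Qed.

Lemma ideal_properP I : ideal A I -> I <> A <-> ~ I 1.
Proof.
move=> [[_ _ IM] IA]; split=> [IneA I1|I1 IeA]; apply: I1 || apply: IneA.
  by apply/seteqP; split=> // x Ax; rewrite -[x]mulr1; exact: IM.
by rewrite IeA; exact: subring1.
Qed.

Lemma prime_ideal_proper P : prime_ideal A P -> ~ P 1.
Proof. by move=> [idP PneA _]; exact/(ideal_properP idP). Qed.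

End SubringTheory.

Definition colon (K : fieldType) (A I : set K) (x : K) : set K :=
  [set a | A a /\ I (a * x)].

Section Colon.
Context (K : fieldType) (A : set K) (hA : subring A).

Lemma colon_ideal I x : submodule A I -> ideal A (colon A I x).
Proof.
move=> [I0 ID IM]; split; last by move=> a [].
split=> [|a b [Aa Ia] [Ab Ib]|a b Aa [Ab Ib]].
- by split; [exact: subring0 | rewrite mul0r].
- by split; [exact: subringD | rewrite mulrDl; exact: ID].
- by split; [exact: subringM | rewrite -mulrA; exact: IM].
Qed.

Lemma sub_colon I x : ideal A I -> A x -> I `<=` colon A I x.
Proof.
by move=> [[_ _ IM] IA] Ax a Ia; split; [exact: IA | rewrite mulrC; exact: IM].
Qed.

(** If x y is in M and x is not, then (M : x) is a proper member of the class
    that contains M, so it equals M; and y belongs to it.  This works for any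
    class of ideals closed under colons, in particular without multiplying
    t-ideals. *)
Lemma maximal_prime (Phi : set K -> Prop) M :
    ideal A M -> M <> A -> (forall x, A x -> Phi (colon A M x)) ->
    (forall I, Phi I -> I <> A -> M `<=` I -> I = M) ->
  prime_ideal A M.
Proof.
move=> idM MneA Phi_colon maxM; split=> // x y Ax Ay Mxy.
have [Mx|Mx] := pselect (M x); [by left | right].
have idC : ideal A (colon A M x) by apply: colon_ideal; case: idM.
have CneA : colon A M x <> A.
  by apply/(ideal_properP hA idC) => -[_]; rewrite mul1r.
by rewrite -(maxM _ (Phi_colon _ Ax) CneA (sub_colon idM Ax)); split=> //;
  rewrite mulrC.
Qed.

End Colon.

(** The chains fed to Zorn's lemma may be empty, whereas classes of proper
    ideals are only closed under unions of nonempty chains; maximizing U in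
    [I `|` U] turns the empty union into I. *)
Lemma Zorn_above (T : Type) (Phi : set (set T)) (I : set T) :
    (forall F, F !=set0 -> F `<=` Phi -> total_on F subset ->
       Phi (\bigcup_(J in F) J)) ->
    Phi I ->
  exists M, [/\ Phi M, I `<=` M & forall J, Phi J -> M `<=` J -> J = M].
Proof.
move=> chain PhiI.
have [F FPhi totF|U [PhiU maxU]] := @Zorn_bigcup T [set U | Phi (I `|` U)].
  have [->|/set0P[J0 FJ0]] := eqVneq F set0.
    by rewrite /= bigcup_set0 setU0.
  move=> /=; suff -> : I `|` \bigcup_(J in F) J =
      \bigcup_(J in [set I `|` J | J in F]) J.
    apply: chain.
    - by exists (I `|` J0), J0.
    - by move=> _ [J FJ <-]; exact: FPhi.
    - move=> _ _ [J FJ <-] [J' FJ' <-].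
      by case: (totF J J' FJ FJ') => JJ'; [left | right]; exact: setUS.
  apply/seteqP; split=> x.
    case=> [Ix|[J FJ Jx]]; first by exists (I `|` J0); [exists J0 | left].
    by exists (I `|` J); [exists J | right].
  by move=> [_ [J FJ <-] [Ix|Jx]]; [left | right; exists J].
exists (I `|` U); split=> [//|x|J PhiJ IUJ]; first by left.
have IJ : I `<=` J by move=> x Ix; apply: IUJ; left.
have UJ : U `<=` J by move=> x Ux; apply: IUJ; right.
apply: contrapT => JneM; apply: (maxU J) => /=.
  by split=> // JU; apply: JneM; apply/seteqP; split=> // x /JU; right.
rewrite (_ : I `|` J = J) //.
by apply/seteqP; split=> x; [case=> // /IJ | right].
Qed.

(** The source of all closure properties of chain unions: a finite subset of the
    union of a chain lies in a single member. *)
Lemma chain_bigcup_seq (T : choiceType) (F : set (set T)) (s : seq T) :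
    F !=set0 -> total_on F subset ->
    (forall x, x \in s -> (\bigcup_(J in F) J) x) ->
  exists2 J, F J & forall x, x \in s -> J x.
Proof.
move=> [J0 FJ0] totF; elim: s => [|x s IHs] sF; first by exists J0.
have [y ys|J FJ sJ] := IHs; first by apply: sF; rewrite inE ys orbT.
have [J' FJ' J'x] := sF x (mem_head _ _).
by case: (totF J J' FJ FJ') => JJ';
  [exists J' => // y | exists J => // y]; rewrite inE => /predU1P[->|/sJ] //;
  [exact: JJ' | exact: JJ'].
Qed.

Section ChainIdeals.
Context (K : fieldType) (A : set K) (hA : subring A).

Lemma chain_ideal (F : set (set K)) :
    F !=set0 -> total_on F subset -> (forall I, F I -> ideal A I) ->
  ideal A (\bigcup_(J in F) J).
Proof.
move=> F0 totF idF; split; last by move=> x [J /idF[_ JA] /JA].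
have [J0 FJ0] := F0; split.
- by exists J0 => //; have [[]] := idF _ FJ0.
- move=> x y xF yF; have [z|J FJ sJ] := @chain_bigcup_seq _ F [:: x; y] F0 totF.
    by rewrite !inE => /orP[] /eqP ->.
  have [[_ JD _] _] := idF _ FJ.
  by exists J => //; apply: JD; apply: sJ; rewrite !inE eqxx ?orbT.
- move=> a x Aa [J FJ Jx]; exists J => //.
  by have [[_ _ JM] _] := idF _ FJ; exact: JM.
Qed.

Lemma exists_maximal_proper (Phi : set K -> Prop) I :
    (forall J, Phi J -> ideal A J) ->
    (forall F : set (set K), F !=set0 -> total_on F subset -> F `<=` Phi ->
       Phi (\bigcup_(J in F) J)) ->
    Phi I -> I <> A ->
  exists M, [/\ Phi M, M <> A, I `<=` M &
               forall J, Phi J -> J <> A -> M `<=` J -> J = M].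
Proof.
move=> Phi_id chain PhiI IneA.
have [F F0 FPhi totF||M [[PhiM MneA] IM maxM]] :=
    @Zorn_above K [set J | Phi J /\ J <> A] I.
- have PhiU : Phi (\bigcup_(J in F) J) by apply: chain => // J /FPhi[].
  split=> //; apply/(ideal_properP hA (Phi_id _ PhiU)) => -[J FJ].
  by have [PhiJ JneA] := FPhi _ FJ; apply/(ideal_properP hA (Phi_id _ PhiJ)).
- by split.
- by exists M; split=> // J PhiJ JneA; apply: maxM.
Qed.

End ChainIdeals.

(** * t-ideals *)

Section TIdeals.
Context (K : fieldType) (A : set K).
Implicit Types (I J : set K) (s : seq K).

(** The finitary core of being a t-ideal: the v-closure of a submodule depends
    only on its generators, so finite lists can replace finitely generated
    ideals. *)
Definition v_closed I : Prop :=
  forall s, (forall x, x \in s -> I x) -> v_closure A [set` s] `<=` I.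

Lemma v_closureS I J : I `<=` J -> v_closure A I `<=` v_closure A J.
Proof. by move=> IJ x xI a aJ; apply: xI => y /IJ; exact: aJ. Qed.

Context (hA : subring A).

(** 1 lies in the inverse of any subset of A. *)
Lemma v_closed_subring : v_closed A.
Proof.
move=> s sA x; rewrite -{2}[x]mulr1; apply => y /= ys.
by rewrite mul1r; exact: sA.
Qed.

Lemma sub_v_closure I : I `<=` v_closure A I.
Proof. by move=> x Ix a; rewrite mulrC; apply. Qed.

Lemma v_closure_generated s J :
  generated_by A s J -> v_closure A J = v_closure A [set` s].
Proof.
move=> [[J0 JD JM] sJ minJ]; congr inverse_ideal; apply/seteqP; split=> a aJ.
  by move=> x /= /sJ; exact: aJ.
suff JI : J `<=` [set x | A (a * x)] by move=> x /JI.
apply: minJ => //=; split=> [|x y Ax Ay|b x Ab Ax] /=.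
- by rewrite mulr0; exact: subring0.
- by rewrite mulrDr; exact: subringD.
- by rewrite mulrCA; exact: subringM.
Qed.

Lemma generated_exists I s : ideal A I -> (forall x, x \in s -> I x) ->
  exists J, [/\ generated_by A s J, ideal A J & J `<=` I].
Proof.
move=> [subI IA] sI.
pose J := \bigcap_(L in [set L | submodule A L /\ forall x, x \in s -> L x]) L.
have JI : J `<=` I by move=> x; apply.
have subJ : submodule A J.
  split=> [L [[]] //|x y Jx Jy L hL|a x Aa Jx L hL].
    by have [[_ LD _] _] := hL; apply: LD; [exact: Jx | exact: Jy].
  by have [[_ _ LM] _] := hL; apply: LM => //; exact: Jx.
exists J; split=> //; last by split=> // x /JI /IA.
by split=> // [x xs L [_]|L subL sL x]; apply.
Qed.

Lemma nonzero_elt I : I 0 -> I <> [set 0] -> exists2 x, I x & x != 0.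
Proof.
move=> I0 In0; apply: contrapT => noI; apply: In0; apply/seteqP; split=> x /=.
  by move=> Ix; apply/eqP; apply: contrapT => /negP x0; apply: noI; exists x.
by move->.
Qed.

Lemma nonzero_neq0 I x : I x -> x != 0 -> I <> [set 0].
Proof. by move=> Ix /eqP x0 I0; apply: x0; rewrite I0 in Ix. Qed.

(** The finitely generated ideals in the definition of the t-closure must be
    nonzero; adjoining a fixed nonzero element c of I to a list s achieves this
    and only enlarges its v-closure. *)
Lemma t_idealP I :
  t_ideal A I <-> [/\ ideal A I, I <> [set 0] & v_closed I].
Proof.
suff fgJ c s : ideal A I -> I c -> c != 0 -> (forall x, x \in s -> I x) ->
    v_closure A [set` s] `<=` t_closure A I.
  split=> -[idI In0 closI]; split=> //.
    have [[I0 _ _] _] := idI; have [c Ic c0] := nonzero_elt I0 In0.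
    by move=> s sI; rewrite -[X in _ `<=` X]closI; exact: fgJ Ic c0 sI.
  have [[I0 _ _] _] := idI; have [c Ic c0] := nonzero_elt I0 In0.
  apply/seteqP; split=> x; last first.
    move=> Ix; apply: (fgJ c [:: x]) => //.
      by move=> y; rewrite inE => /eqP ->.
    by apply: sub_v_closure; rewrite /= inE.
  move=> [J [_ _ [s sJ] JI]]; rewrite (v_closure_generated sJ).
  by apply: closI => y ys; apply: JI; case: sJ => _ + _; apply.
move=> idI Ic c0 sI x xs.
have csI y : y \in c :: s -> I y by rewrite inE => /predU1P[->//|/sI].
have [J [genJ idJ JI]] := generated_exists idI csI.
have Jc : J c by case: genJ => _ + _; apply; exact: mem_head.
exists J; split=> //.
- split; first by case: idJ.
  exists 1; split; [exact: subring1 | exact: oner_neq0 |].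
  by move=> y Jy; rewrite mul1r; case: idJ => _; apply.
- exact: nonzero_neq0 Jc c0.
- by exists (c :: s).
- rewrite (v_closure_generated genJ); apply: v_closureS xs => y /= ys.
  by rewrite inE ys orbT.
Qed.

(** If z is in the v-closure of s then z x is in that of s x; x may be any
    element of K, so this also covers the ideals of denominators (A : x). *)
Lemma v_closed_colon I x : v_closed I -> v_closed (colon A I x).
Proof.
move=> closI s sC z zs; split.
  by apply: (v_closed_subring _ zs) => y /sC[].
apply: (closI [seq y * x | y <- s]).
  by move=> _ /mapP[y /sC[_ Iyx] ->].
move=> w ws; rewrite mulrAC -mulrA; apply: zs => y /= ys.
rewrite mulrAC -mulrA; apply: ws => /=; exact: map_f.
Qed.

Lemma t_ideal_colon I x : t_ideal A I -> A x -> t_ideal A (colon A I x).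
Proof.
move=> /t_idealP[idI In0 closI] Ax; apply/t_idealP; split.
- by apply: colon_ideal => //; case: idI.
- have [[I0 _ _] _] := idI; have [c Ic c0] := nonzero_elt I0 In0.
  exact: nonzero_neq0 (sub_colon idI Ax Ic) c0.
- exact: v_closed_colon.
Qed.

(** This colon ideal contains a denominator of x, hence is nonzero. *)
Lemma denominators_t_ideal x :
  is_quotient_field A -> t_ideal A (colon A A x).
Proof.
move=> [_ /(_ x)[a [b [Aa Ab b0 ->]]]]; apply/t_idealP; split.
- exact/colon_ideal/subring_submodule.
- apply: (@nonzero_neq0 _ b) => //; split=> //.
  by rewrite mulrC divfK.
- exact/v_closed_colon/v_closed_subring.
Qed.

Lemma chain_t_ideal (F : set (set K)) :
    F !=set0 -> total_on F subset -> F `<=` t_ideal A ->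
  t_ideal A (\bigcup_(J in F) J).
Proof.
move=> F0 totF tF; have [J0 FJ0] := F0.
apply/t_idealP; split.
- by apply: chain_ideal => // I /tF[].
- have [[[J00 _ _] _] J0n0 _] := tF _ FJ0.
  have [c J0c c0] := nonzero_elt J00 J0n0.
  by apply: (@nonzero_neq0 _ c) => //; exists J0.
- move=> s sF x xs; have [J FJ sJ] := chain_bigcup_seq F0 totF sF.
  have /t_idealP[_ _ closJ] := tF _ FJ.
  by exists J => //; exact: closJ xs.
Qed.

End TIdeals.

Section MaximalIdeals.
Context (K : fieldType) (A : set K) (hA : subring A).

Lemma maximal_ideal_prime M : maximal_ideal A M -> prime_ideal A M.
Proof.
move=> [idM MneA maxM]; apply: (@maximal_prime _ _ hA (ideal A)) => // x Ax.
by apply: colon_ideal => //; case: idM.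
Qed.

Lemma maximal_t_ideal_prime M : maximal_t_ideal A M -> prime_t_ideal A M.
Proof.
move=> [tM MneA maxM]; split=> //; have [idM _ _] := tM.
by apply: (@maximal_prime _ _ hA (t_ideal A)) => // x Ax; exact: t_ideal_colon.
Qed.

Lemma exists_maximal_ideal I : ideal A I -> I <> A ->
  exists2 M, maximal_ideal A M & I `<=` M.
Proof.
move=> idI IneA; have [//|F F0 totF idF||//|M [idM MneA IM maxM]] :=
  @exists_maximal_proper _ _ hA (ideal A) I.
- exact: chain_ideal.
- by [].
- by exists M.
Qed.

Lemma exists_maximal_t_ideal I : t_ideal A I -> I <> A ->
  exists2 M, maximal_t_ideal A M & I `<=` M.
Proof.
move=> tI IneA; have [J []//|F F0 totF tF||//|M [tM MneA IM maxM]] :=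
  @exists_maximal_proper _ _ hA (t_ideal A) I.
- exact: chain_t_ideal.
- by [].
- by exists M.
Qed.

End MaximalIdeals.

(** * Localizations *)

Section Localization.
Context (K : fieldType) (A : set K) (hA : subring A).

Lemma prime_complM P x y : prime_ideal A P ->
  (A `\` P) x -> (A `\` P) y -> (A `\` P) (x * y).
Proof.
move=> [_ _ primeP] [Ax Px] [Ay Py]; split; first exact: subringM.
by case/primeP.
Qed.

Lemma sub_localization_at P : prime_ideal A P -> A `<=` localization_at A P.
Proof.
move=> /(prime_ideal_proper hA) P1 x Ax; exists x, 1; split=> //.
  by split=> //; exact: subring1.
by rewrite divr1.
Qed.

Lemma compl_neq0 P x : prime_ideal A P -> (A `\` P) x -> x != 0.
Proof.
by move=> [[[P0 _ _] _] _ _] [_ Px]; apply/eqP => x0; apply: Px; rewrite x0.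
Qed.

(** Elements of A_P are those with a denominator outside P; in this form
    quotients no longer appear. *)
Lemma localization_atP P x : prime_ideal A P ->
  localization_at A P x <-> exists2 s, (A `\` P) s & A (s * x).
Proof.
move=> pP; split=> [[a [s [Aa Ss ->]]]|[s Ss Asx]].
  by exists s => //; rewrite mulrC divfK //; exact: compl_neq0 Ss.
exists (s * x), s; split=> //; rewrite mulrC mulKf //; exact: compl_neq0 Ss.
Qed.

Lemma common_denominator P (s : seq K) : prime_ideal A P ->
    (forall x, x \in s -> localization_at A P x) ->
  exists2 u, (A `\` P) u & forall x, x \in s -> A (u * x).
Proof.
move=> pP; elim: s => [|x s IHs] sP.
  exists 1 => //; split; [exact: subring1 | exact: (prime_ideal_proper hA pP)].
have [y ys|u Su us] := IHs; first by apply: sP; rewrite inE ys orbT.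
have [v Sv Avx] := (localization_atP x pP).1 (sP x (mem_head _ _)).
exists (v * u); first exact: prime_complM.
move=> y; rewrite inE => /predU1P[->|/us Auy].
  by rewrite mulrAC; apply: subringM => //; case: Su.
by rewrite -mulrA; apply: subringM => //; case: Sv.
Qed.

Lemma localization_trans P M :
    prime_ideal A P -> prime_ideal A M -> P `<=` M ->
  localization (localization_at A M) (A `\` P) = localization_at A P.
Proof.
move=> pP pM PM; apply/seteqP; split=> x; last first.
  move=> [a [s [Aa Ss ->]]]; exists a, s; split=> //.
  exact: sub_localization_at.
move=> [_ [s [[a [t [Aa [At Mt] ->]]] Ss ->]]]; exists a, (t * s); split=> //.
  by apply: prime_complM => //; split=> // /PM.
by rewrite invfM mulrA.
Qed.

Lemma multiplicative_compl P M : prime_ideal A P -> prime_ideal A M ->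
  Defs.multiplicative (localization_at A M) (A `\` P).
Proof.
move=> pP pM; split.
- by move=> x [Ax _]; exact: sub_localization_at.
- by split; [exact: subring1 | exact: (prime_ideal_proper hA pP)].
- by move=> /(compl_neq0 pP); rewrite eqxx.
- by move=> x y; exact: prime_complM.
Qed.

Lemma stable_localization (X : idomainType -> Prop) P M :
    stable_under_quotient_extension X ->
    prime_ideal A P -> prime_ideal A M -> P `<=` M ->
  has_property X (localization_at A M) -> has_property X (localization_at A P).
Proof.
move=> stabX pP pM PM; rewrite -(localization_trans pP pM PM).
exact/stabX/multiplicative_compl.
Qed.

(** A domain is the intersection of its localizations at prime t-ideals: if x is
    not in A, its denominators form a proper t-ideal, and x is not in the
    localization at a maximal t-ideal containing it. *)
Lemma mem_localizations x : is_quotient_field A ->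
  (forall Q, prime_t_ideal A Q -> localization_at A Q x) -> A x.
Proof.
move=> qfA xQ; apply: contrapT => Ax.
have tC := denominators_t_ideal hA x qfA.
have CneA : colon A A x <> A.
  by case: (tC) => idC _ _; apply/(ideal_properP hA idC) => -[_]; rewrite mul1r.
have [M /(maximal_t_ideal_prime hA) pM CM] := exists_maximal_t_ideal hA tC CneA.
have /localization_atP[|s [As Ms] Asx] := xQ M pM; first by case: pM.
by apply: Ms; apply: CM.
Qed.

End Localization.

Section Contraction.
Context (K : fieldType) (A T : set K) (hA : subring A) (hT : subring T).
Context (AT : A `<=` T).

Lemma prime_contraction Q : prime_ideal T Q -> prime_ideal A (Q `&` A).
Proof.
move=> pQ; have Q1 := prime_ideal_proper hT pQ.
have [[[Q0 QD QM] QT] QneT primeQ] := pQ.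
split.
- split; last by move=> x [].
  split=> [|x y [Qx Ax] [Qy Ay]|a x Aa [Qx Ax]].
  + by split=> //; exact: subring0.
  + by split; [exact: QD | exact: subringD].
  + by split; [apply: QM => //; exact: AT | exact: subringM].
- by move=> QA; apply: Q1; have := subring1 hA; rewrite -{1}QA => -[].
- move=> x y Ax Ay [/primeQ Qxy _].
  by have [||Qx|Qy] := Qxy; [exact: AT | exact: AT | left | right].
Qed.

(** Denominators for all of T outside Q make T, and then T_Q, part of the
    localization of A: with u t and v t x in A, the element x is the quotient of
    u (v t x) by v (u t). *)
Lemma localization_contraction Q : prime_ideal T Q ->
    (forall x, T x -> exists2 s, A s /\ ~ Q s & A (s * x)) ->
  localization_at T Q = localization_at A (Q `&` A).
Proof.
move=> pQ den; have pP := prime_contraction pQ.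
apply/seteqP; split=> x.
  move=> /(localization_atP x pQ)[t [Tt Qt] Ttx].
  have [u [Au Qu] Aut] := den _ Tt; have [v [Av Qv] Avtx] := den _ Ttx.
  apply/(localization_atP x pP); exists (v * (u * t)).
    split; first exact: subringM.
    case=> + _; case: pQ => _ _ primeQ;
    case/primeQ; [exact: AT | exact: AT | by [] |].
    by case/primeQ => //; exact: AT.
  have -> : v * (u * t) * x = u * (v * (t * x)) by ring.
  exact: subringM.
move=> [a [s [Aa [As Qs] ->]]]; exists a, s; split=> //; first exact: AT.
by split; [exact: AT | move=> Qs'; apply: Qs].
Qed.

Lemma quotient_field_overring : is_quotient_field A -> is_quotient_field T.
Proof.
move=> [_ qf]; split=> // x; have [a [b [Aa Ab b0 ->]]] := qf x.
by exists a, b; split=> //; exact: AT.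
Qed.

(** Let x be in the v-closure of s over A, with s contained in Q, and let w
    multiply s into T.  At each prime t-ideal Q' of T the finite set w s lies
    in A_(Q' /\ A), so some u outside Q' has u w s in A, whence u w x is in A
    and w x is in T_Q'.  Thus w x is in T, that is, x is in the v-closure of s
    over T. *)
Lemma t_flat_contraction Q : is_quotient_field A -> t_flat_overring A T ->
  prime_t_ideal T Q -> prime_t_ideal A (Q `&` A).
Proof.
move=> qfA [_ flatT] [pQ tQ]; have pP := prime_contraction pQ.
split=> //; have [[[Q0 _ QM] QT] Qn0 closQ] := (t_idealP hT _).1 tQ.
apply/(t_idealP hA); split.
- by case: pP.
- have [q Qq q0] := nonzero_elt Q0 Qn0.
  have [_ /(_ q)[a [b [Aa Ab b0 qE]]]] := qfA.
  have aE : a = b * q by rewrite qE mulrC divfK.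
  apply: (@nonzero_neq0 _ _ a); last by rewrite aE mulf_neq0.
  by split=> //; rewrite aE; apply: QM => //; exact: AT.
- move=> s sP x xs; split; last first.
    by apply: (v_closed_subring _ xs) => y /sP[].
  apply: (closQ s) => [y /sP[]//|w ws].
  apply: (mem_localizations hT (quotient_field_overring qfA)) => Q' tQ'.
  have pQ' : prime_ideal T Q' by case: tQ'.
  have pP' := prime_contraction pQ'.
  rewrite (flatT _ tQ'); apply/(localization_atP _ pP').
  have [_ /mapP[y ys ->]|u Su us] :=
      @common_denominator _ _ hA _ [seq w * y | y <- s] pP'.
    rewrite -(flatT _ tQ'); apply: (sub_localization_at hT pQ').
    exact: ws.
  exists u => //; rewrite mulrCA; apply: xs => y /= ys.
  by rewrite -mulrA; apply: us; exact: map_f.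
Qed.

End Contraction.
(** * Flat overrings *)

Section Submodule.
Context (R : comNzRingType) (V : lmodType R) (S : {pred V}).

(** A submodule as a module in its own right: it gives the injections on which
    flatness is tested. *)
Definition submod_pred of submod_closed S : {pred V} := S.

HB.instance Definition _ (hS : submod_closed S) :=
  GRing.isSubmodClosed.Build R V (submod_pred hS) hS.

Definition submod_type (hS : submod_closed S) : Type :=
  {x : V | x \in submod_pred hS}.

HB.instance Definition _ (hS : submod_closed S) :=
  SubChoice.on (submod_type hS).
HB.instance Definition _ (hS : submod_closed S) :=
  [SubChoice_isSubLmodule of submod_type hS by <:].

End Submodule.

Lemma freeg_gen (T : choiceType) (H : set {freeg T / int}) :
    H 0 -> (forall x y, H x -> H y -> H (x - y)) -> (forall k, H << k >>) ->
  forall z, H z.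
Proof.
move=> H0 HB Hk z; rewrite -[z]freeg_sumE.
have HN x : H x -> H (- x) by move=> Hx; rewrite -sub0r; exact: HB.
have HD x y : H x -> H y -> H (x + y).
  by move=> Hx Hy; rewrite -[y]opprK; apply/HB/HN.
have HMn x n : H x -> H (x *+ n).
  by move=> Hx; elim: n => // n IHn; rewrite mulrS; exact: HD.
apply: big_ind => // k _; rewrite -[coeff k z]intz -freegU_mulz.
by case: (coeff k z) => n; [exact: HMn | exact/HN/HMn].
Qed.

Section Lift.
Context (T : choiceType) (M : lmodType int) (f : T -> M).

Lemma fgliftB : {morph fglift f : x y / x - y}.
Proof. exact: lift_is_additive. Qed.

Lemma fglift0 : fglift f 0 = 0.
Proof. by rewrite -[X in fglift f X](subrr 0) fgliftB subrr. Qed.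

Lemma fgliftU k : fglift f << k >> = f k.
Proof. by rewrite liftU scale1r. Qed.

End Lift.

Section Tensor.
Context (R : comNzRingType) (M V : lmodType R).

(** A map b that is bilinear up to a subgroup H of G sends null tensors into H.
    Working modulo H makes it unnecessary to form quotient modules. *)
Lemma tensor_null_lift (G : zmodType) (b : M * V -> G) (H : set G)
    (z : {freeg (M * V)%type / int}) :
    H 0 -> (forall x y, H x -> H y -> H (x - y)) ->
    (forall m1 m2 v, H (b (m1 + m2, v) - b (m1, v) - b (m2, v))) ->
    (forall m v1 v2, H (b (m, v1 + v2) - b (m, v1) - b (m, v2))) ->
    (forall r m v, H (b (r *: m, v) - b (m, r *: v))) ->
  tensor_null z -> H (fglift (b : M * V -> ssrint.zmodule G) z).
Proof.
move=> H0 HB Hl Hr Hm /(_ [set y | H (fglift (b : _ -> ssrint.zmodule G) y)]).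
apply.
- by rewrite /= fglift0.
- by move=> x y Hx Hy; rewrite /= fgliftB; exact: HB.
- by move=> _ [[m1 [m2 [v ->]]]|[[m [v1 [v2 ->]]]|[r [m [v ->]]]]] /=;
    rewrite !fgliftB !fgliftU.
Qed.

End Tensor.

(** The evaluation m (x) r |-> r m is injective on M (x) A, because z is
    congruent to ev z (x) 1 for every z; and it commutes with f. *)
Lemma flat_overring_refl (K : fieldType) (A : set K) :
  subring A -> flat_overring A A.
Proof.
move=> hA; exists hA, hA, (@subset_refl _ A) => M N f injf z fz0.
pose E := ext_module hA hA (@subset_refl _ A).
pose ev (L : lmodType (domain_of hA)) (mv : L * E) : L :=
  (mv.2 : domain_of hA) *: mv.1.
pose evz (L : lmodType (domain_of hA)) (y : {freeg (L * E)%type / int}) : L :=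
  fglift (ev L : _ -> ssrint.zmodule L) y.
have evB L : {morph evz L : x y / x - y}.
  by move=> x y; exact: (fgliftB (ev L : _ -> ssrint.zmodule L)).
have evU L mv : evz L << mv >> = ev L mv.
  exact: (fgliftU (ev L : _ -> ssrint.zmodule L)).
have ev0 L : evz L 0 = 0 by exact: (fglift0 (ev L : _ -> ssrint.zmodule L)).
pose Nf : {freeg (M * E)%type / int} -> {freeg (N * E)%type / int} :=
  fglift (fun mv => << (f mv.1, mv.2) >> : {freeg (N * E)%type / int}).
(* Evaluation is natural in the module. *)
have evN y : evz N (Nf y) = f (evz M y).
  apply: (freeg_gen (H := [set y | evz N (Nf y) = f (evz M y)])) => /=.
  - by rewrite /Nf fglift0 !ev0 raddf0.
  - by move=> y1 y2 e1 e2; rewrite /Nf fgliftB !evB e1 e2 raddfB.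
  - by move=> k; rewrite /Nf fgliftU !evU /ev linearZ.
have evz0 : evz M z = 0.
  apply: injf; rewrite raddf0 -evN.
  apply: (@tensor_null_lift _ _ _ _ (ev N) [set 0] _ _ _ _ _ _ fz0) => /=.
  - by [].
  - by move=> x y -> ->; rewrite subr0.
  - by move=> m1 m2 v; rewrite /ev /= scalerDr addrAC addrK subrr.
  - by move=> m v1 v2; rewrite /ev /= scalerDl addrAC addrK subrr.
  - move=> r m v; rewrite /ev /= !scalerA; apply/eqP; rewrite subr_eq0.
    by apply/eqP; congr (_ *: _); apply: val_inj; rewrite /= mulrC.
move=> H H0 HB Hrel.
have HN x : H x -> H (- x) by move=> Hx; rewrite -sub0r; exact: HB.
have HD x y : H x -> H y -> H (x + y).
  by move=> Hx Hy; rewrite -[y]opprK; apply/HB/HN.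
have regroup (G : zmodType) (x a y b c : G) :
    x - a - (y - b) + (a - c - b) = x - y - c.
  by rewrite opprB [a - c - b]addrAC addrA [x - a + _ + _]addrAC !subrKA.
pose e : E := (1 : domain_of hA).
have Hlin m1 m2 : H (<< (m1 + m2, e) >> - << (m1, e) >> - << (m2, e) >>).
  by apply: Hrel; left; exists m1, m2, e.
have H0e : H << (0, e) >>.
  rewrite -[<< _ >>]opprK; apply: HN.
  by have := Hlin 0 0; rewrite addr0 subrr sub0r.
(* Every tensor z is congruent to ev z (x) 1. *)
have Hz y : H (y - << (evz M y, e) >>).
  apply: (freeg_gen (H := [set y | H (y - << (evz M y, e) >>)])) => /=.
  - by rewrite ev0 sub0r; exact: HN.
  - move=> x1 x2 Hx1 Hx2; rewrite evB.
    have := HD _ _ (HB _ _ Hx1 Hx2) (Hlin (evz M x1 - evz M x2) (evz M x2)).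
    by rewrite subrK regroup.
  - move=> [m r]; rewrite evU -opprB; apply: HN; apply: Hrel; right; right.
    exists (r : domain_of hA), m, e; congr (_ - << (_, _) >>).
    by apply: val_inj; rewrite /= mulr1.
by rewrite -[z](subrK << (evz M z, e) >>) {2}evz0; apply: HD.
Qed.

Section FlatDenominators.
Context (K : fieldType) (A T Q : set K).
Context (hA : subring A) (hT : subring T) (AT : A `<=` T).

Let R : comNzRingType := domain_of hA.
Context (x b : K).

(** Elements of bA + b x A are m = b (u + v x) with u and v in A, and v is a
    coefficient of m.  It is unique up to the ideal of denominators of x, so
    that m |-> v stands for the map bA + b x A -> A / (A : x). *)
Let coefficient (m v : K) : Prop := A v /\ A (m / b - v * x).

(** The ideal bA + b x A. *)
Let two_generated : {pred R^o} :=
  [pred m | `[< exists v, coefficient (val m) v >]].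

Let coefficient0 : coefficient 0 0.
Proof. by split; rewrite ?mul0r ?subrr; exact: subring0. Qed.

Let coefficientD m n v w :
  coefficient m v -> coefficient n w -> coefficient (m + n) (v + w).
Proof.
move=> [Av mv] [Aw nw]; split; first exact: subringD.
have -> : (m + n) / b - (v + w) * x = (m / b - v * x) + (n / b - w * x).
  by ring.
exact: subringD.
Qed.

Let coefficientM r m v : A r -> coefficient m v -> coefficient (r * m) (r * v).
Proof.
move=> Ar [Av mv]; split; first exact: subringM.
have -> : (r * m) / b - (r * v) * x = r * (m / b - v * x) by ring.
exact: subringM.
Qed.

Let val_sub (r : R) : A (val r).
Proof. exact/set_mem/valP. Qed.

Let two_generated_submod : submod_closed two_generated.
Proof.
split=> [|r m n /asboolP[v mv] /asboolP[w nw]]; apply/asboolP.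
  by exists 0; exact: coefficient0.
by exists (val r * v + w); apply: coefficientD => //; exact: coefficientM.
Qed.

(** If all denominators of x were in Q, the map (m, t) |-> v t, with v a
    coefficient of m, would be bilinear modulo Q.  The tensor
    b x (x) 1 - b (x) x is null in A (x) T, hence in (bA + b x A) (x) T by
    flatness; as b x has coefficient 1 and b has coefficient 0, its image is 1
    modulo Q, contradicting that Q is proper. *)
Lemma flat_denominator :
    flat_module (ext_module hA hT AT) -> A b -> b != 0 -> A (b * x) ->
    T x -> ideal T Q -> Q <> T ->
  exists2 s, A s /\ ~ Q s & A (s * x).
Proof.
move=> flatT Ab b0 Aa Tx idQ QneT; apply: contrapT => noden.
have denQ s : A s -> A (s * x) -> Q s.
  by move=> As Asx; apply: contrapT => Qs; apply: noden; exists s.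
have [[Q0 QD QM] _] := idQ.
have QB y z : Q y -> Q z -> Q (y - z).
  by move=> Qy Qz; apply: (submoduleB hT) => //; case: idQ.
have cQ m v w : coefficient m v -> coefficient m w -> Q (v - w).
  move=> [Av mv] [Aw mw]; apply: denQ; first exact: subringB.
  have -> : (v - w) * x = (m / b - w * x) - (m / b - v * x) by ring.
  exact: subringB.
pose M := submod_type two_generated_submod.
pose E := ext_module hA hT AT.
have cE (m : M) : exists v, coefficient (val (val m : R)) v.
  exact/asboolP/(valP m).
have [c cP] := choice cE.
have inA y : A y -> y \in subring_pred hA by move=> /mem_set.
have inM y v (Ay : A y) : coefficient y v ->
    (Sub y (inA y Ay) : R^o) \in submod_pred two_generated_submod.
  by move=> yv; apply/asboolP; exists v.
have a1 : coefficient (b * x) 1.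
  split; first exact: subring1.
  by rewrite mulrAC mulfV // subrr; exact: subring0.
have b1 : coefficient b 0.
  split; first exact: subring0.
  by rewrite mulfV // mul0r subr0; exact: subring1.
pose ma : M := Sub (Sub (b * x) (inA _ Aa) : R^o) (inM _ _ Aa a1).
pose mb : M := Sub (Sub b (inA _ Ab) : R^o) (inM _ _ Ab b1).
pose e : E := (1 : domain_of hT).
pose xE : E := (Sub x (mem_set Tx) : domain_of hT).
pose z : {freeg (M * E)%type / int} := << (ma, e) >> - << (mb, xE) >>.
have z_null : tensor_null z.
  apply: (flatT M R^o val); first exact: val_inj.
  rewrite /z fgliftB !fgliftU /= => H H0 HB Hrel.
  (* In A (x) T both terms equal 1 (x) b x. *)
pose one : R^o := (1 : R).
  have -> : Sub (b * x) (inA _ Aa) = (Sub (b * x) (inA _ Aa) : R) *: one :> R^o.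
    by apply: val_inj; rewrite /= mulr1.
  have -> : Sub b (inA _ Ab) = (Sub b (inA _ Ab) : R) *: one :> R^o.
    by apply: val_inj; rewrite /= mulr1.
  set ra : R := Sub (b * x) _; set rb : R := Sub b _.
  have rab : ra *: e = rb *: xE by apply: val_inj; rewrite /= mulr1.
  have Ha : H (<< (ra *: one, e) >> - << (one, ra *: e) >>).
    by apply: Hrel; right; right; exists ra, one, e.
  have Hb : H (<< (rb *: one, xE) >> - << (one, rb *: xE) >>).
    by apply: Hrel; right; right; exists rb, one, xE.
  have := HB _ _ Ha Hb.
  by rewrite rab opprB addrA subrK.
pose g (mt : M * E) : K := c mt.1 * val (mt.2 : domain_of hT).
have TE (t : E) : T (val (t : domain_of hT)) by exact/set_mem/valP.
have valvalD (m n : M) :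
  val (val (m + n) : R) = val (val m : R) + val (val n : R).
  by rewrite [val (m + n)]raddfD.
have valvalZ (r : R) (m : M) :
  val (val (r *: m) : R) = val r * val (val m : R).
  by rewrite [val (r *: m)]linearZ.
have Qz : Q (fglift (g : _ -> ssrint.zmodule K) z).
  apply: (@tensor_null_lift _ _ _ _ g Q z) z_null => //.
  - move=> m1 m2 t; rewrite /g /= -!mulrBl mulrC -addrA -opprD.
    apply: QM; first exact: TE.
    apply: (cQ _ _ _ (cP _)).
    by rewrite valvalD; exact: (coefficientD (cP m1) (cP m2)).
  - by move=> m t1 t2; rewrite /g /= -addrA -opprD -mulrDr subrr.
  - move=> r m t; rewrite /g /= mulrCA mulrA -mulrBl mulrC.
    apply: QM; first exact: TE.
    apply: (cQ _ _ _ (cP _)).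
    by rewrite valvalZ; exact: (coefficientM (val_sub r) (cP m)).
have QneT1 : ~ Q 1 by exact/(ideal_properP hT idQ).
apply: QneT1.
have Qa : Q (1 - c ma) by exact: (cQ _ _ _ a1 (cP ma)).
have Qb : Q (x * (c mb - 0)) by apply: QM => //; exact: (cQ _ _ _ (cP mb) b1).
move: Qz; rewrite /z fgliftB !fgliftU /g /= => Qz.
have -> : 1 = (1 - c ma) + ((c ma * 1 - c mb * x) + x * (c mb - 0)) by ring.
by apply: (QD _ _ Qa); exact: QD.
Qed.

End FlatDenominators.

Lemma flat_localization (K : fieldType) (A T Q : set K) :
    is_quotient_field A -> flat_overring A T -> prime_ideal T Q ->
  localization_at T Q = localization_at A (Q `&` A).
Proof.
move=> [_ qf] [hA [hT [AT flatT]]] pQ.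
apply: localization_contraction => // x Tx.
have [a [b [Aa Ab b0 xE]]] := qf x; have [idQ QneT _] := pQ.
apply: (flat_denominator (b := b) flatT) => //.
by rewrite xE mulrC divfK.
Qed.

Lemma t_flat_overring_refl (K : fieldType) (A : set K) :
  subring A -> t_flat_overring A A.
Proof.
move=> hA; split=> [|Q [[[_ QA] _ _] _]]; first by split.
congr localization_at; apply/seteqP; split=> x; last by case.
by split=> //; exact: QA.
Qed.

Theorem proposition2p1 (K : fieldType) (D : set K) (hD : is_quotient_field D)
    (X : idomainType -> Prop) (hX : iso_invariant X) :
  [/\ locally X D <->
        (forall T : set K, flat_overring D T -> locally X T),
      t_locally X D <->
        (forall T : set K, t_flat_overring D T -> t_locally X T)
    & stable_under_quotient_extension X ->
        (locally X D <->
           (forall M : set K, maximal_ideal D M ->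
              has_property X (localization_at D M))) /\
        (t_locally X D <->
           (forall M : set K, maximal_t_ideal D M ->
              has_property X (localization_at D M)))].
Proof.
have sD : subring D by case: hD.
split.
- split=> [locD T flatT Q pQ|]; last by apply; exact: flat_overring_refl.
  rewrite (flat_localization hD flatT pQ); apply: locD.
  by have [hA [hT [DT _]]] := flatT; exact: prime_contraction pQ.
- split=> [locD T flatT Q pQ|]; last by apply; exact: t_flat_overring_refl.
  have [[hT DT] locE] := flatT; rewrite locE //; apply: locD.
  exact: (t_flat_contraction sD hT DT hD flatT pQ).
move=> stabX; split; split=> [locD M maxM|locM P pP].
- exact/locD/maximal_ideal_prime.
- have [idP PneD _] := pP; have [M maxM PM] := exists_maximal_ideal sD idP PneD.
  have pM := maximal_ideal_prime sD maxM.
  exact: (stable_localization sD stabX pP pM PM (locM _ maxM)).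
- exact/locD/maximal_t_ideal_prime.
- have [ppP tP] := pP; have [_ PneD _] := ppP.
  have [M maxM PM] := exists_maximal_t_ideal sD tP PneD.
  have [pM _] := maximal_t_ideal_prime sD maxM.
  exact: (stable_localization sD stabX ppP pM PM (locM _ maxM)).
Qed.
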